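(* Let $(A,p_+)$ be a unital idempotent Rota–Baxter algebra over $k$, and let $j\in\mathcal{U}(QSh(A),A)$ be the map with $j(1)=1_A$, $j(a_1)=a_1$ and $j(a_1\cdots a_r)=0$ for $r\ge2$. The Birkhoff decomposition $(j_+,j_-)\in\mathcal{U}(QSh(A),A_+)\times\mathcal{U}(QSh(A),A_-)$, i.e. the pair such that $j_-\ast j=j_+$, is given, for $r\ge1$ and $\boldsymbol{a}=a_1\cdots a_r\in A^{\otimes r}$, by $$j_+(\boldsymbol{a})=p_+(\bar j(\boldsymbol{a}))=(-1)^{r-1}p_+(p_-(\ldots(p_-(a_1)\cdot_Aa_2)\ldots\cdot_Aa_{r-1})\cdot_Aa_r),$$ $$j_-(\boldsymbol{a})=-p_-(\bar j(\boldsymbol{a}))=(-1)^{r}p_-(p_-(\ldots(p_-(a_1)\cdot_Aa_2)\ldots\cdot_Aa_{r-1})\cdot_Aa_r)$$ (so for $r=1$: $j_+(a_1)=p_+(a_1)$, $j_-(a_1)=-p_-(a_1)$), where $\bar j$ is the Bogoliubov preparation map of $j$. Moreover, if $A$ is commutative, then the set $\mathcal{C}(QSh(A),A)$ of unital algebra morphisms $QSh(A)\to A$ is a group under convolution, and $j_+$ and $j_-$ are characters, i.e. belong to $\mathcal{C}(QSh(A),A)$.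
   Context: Everything is over a fixed field $k$ of characteristic $0$. Idempotent Rota–Baxter algebra $(A,p_+)$: an associative algebra $A$ (product $\cdot_A$) with an idempotent linear map $p_+:A\to A$ such that $p_+(x)p_+(y)=p_+(p_+(x)y+xp_+(y)-xy)$ for all $x,y\in A$. Put $p_-=\mathrm{Id}-p_+$, $A_\pm=\mathrm{Im}\,p_\pm$; then $A=A_+\oplus A_-$ and $A_\pm$ are subalgebras. $QSh(A)=\bigoplus_{n\ge0}A^{\otimes n}$, $A^{\otimes0}=k$, with $a_1\otimes\cdots\otimes a_n$ written as the word $a_1\cdots a_n$; unit $1\in A^{\otimes 0}$; product $\star$ given by $1\star v=v\star1=v$, $av\star bw=a(v\star bw)+b(av\star w)+(a\cdot_Ab)(v\star w)$ for $a,b\in A$ and words $v,w$; coproduct the deconcatenation $\Delta(a_1\cdots a_s)=\sum_{r=0}^s(a_1\cdots a_r)\otimes(a_{r+1}\cdots a_s)$; counit zero on words of length $\ge1$. It is a conilpotent Hopf algebra; $QSh^+(A)=\bigoplus_{n\ge1}A^{\otimes n}$ and the reduced coproduct on it is $\Delta'(\boldsymbol a)=\Delta(\boldsymbol a)-1\otimes\boldsymbol a-\boldsymbol a\otimes1$. Convolution of linear maps $f,g:QSh(A)\to A$: $f\ast g=m_A\circ(f\otimes g)\circ\Delta$, $m_A$ the product of $A$. $\mathcal{U}(QSh(A),A)$ is the group of linear maps $f$ with $f(1)=1_A$; for a subalgebra $B\subset A$, $\mathcal{U}(QSh(A),B)=\{f\in\mathcal{U}(QSh(A),A): f(QSh^+(A))\subset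 B\}$. The pair $(j_+,j_-)$ in $\mathcal{U}(QSh(A),A_+)\times\mathcal{U}(QSh(A),A_-)$ with $j_-\ast j=j_+$ is known to exist and be unique (Birkhoff decomposition). The Bogoliubov preparation map $\bar j\in\mathcal{U}(QSh(A),A)$ is defined recursively on word length by $\bar j(1)=1_A$ and $\bar j(h)=j(h)-m_A\circ(p_-\otimes\mathrm{Id})\circ(\bar j\otimes j)\circ\Delta'(h)$ for $h\in QSh^+(A)$. *)

(* Defs.v *)
From HB Require Import structures.
From mathcomp Require Import all_boot all_algebra.
From mathcomp Require Import boolp classical_sets.
From mathcomp Require Import finmap monalg.
From mathcomp Require Import generic_quotient ring_quotient.

Set Implicit Arguments.
Unset Strict Implicit.
Unset Printing Implicit Defensive.

Import GRing.Theory.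
Local Open Scope ring_scope.

Definition span (k : fieldType) (V : lmodType k) (S : V -> Prop) : V -> Prop :=
  fun v => exists2 s : seq (k * V), (forall x, x \in s -> S x.2) &
           v = \sum_(x <- s) x.1 *: x.2.

(* Vector space with generators X and relations R: the quotient of the free
   vector space {malg k[X]} by the span of R. *)
Section Presented.
Variables (k : fieldType) (X : choiceType) (R : {malg k[X]} -> Prop).
Local Notation F := {malg k[X]}.

Definition rel_span : {pred F} := fun m => `[< span R m >].

Lemma rel_spanP (m : F) : reflect (span R m) (m \in rel_span).
Proof. exact: asboolP. Qed.

Lemma span_linear (c : k) (u v : F) : span R u -> span R v -> span R (c *: u + v).
Proof.
case=> s Hs -> [t Ht ->].
exists ([seq (c * x.1, x.2) | x <- s] ++ t) => [x|].
  by rewrite mem_cat => /orP[/mapP[y ys ->]|/Ht //]; exact: (Hs _ ys).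
rewrite big_cat big_map scaler_sumr; congr (_ + _).
by apply: eq_bigr => i _; rewrite scalerA.
Qed.

Lemma span0 : span R 0.
Proof. by exists [::]; rewrite ?big_nil. Qed.

Lemma rel_span_zmod_closed : zmod_closed rel_span.
Proof.
split=> [|u v /rel_spanP Hu /rel_spanP Hv]; apply/rel_spanP; first exact: span0.
by rewrite addrC -scaleN1r; exact: span_linear.
Qed.

HB.instance Definition _ := GRing.isZmodClosed.Build F rel_span rel_span_zmod_closed.

Definition presented := Quotient.quot rel_span.

HB.instance Definition _ := ZmodQuotient.on presented.

End Presented.

(* Locked, like gen below: otherwise failed unifications unfold the quotient. *)
HB.lock Definition presented_scale (k : fieldType) (X : choiceType)
    (R : {malg k[X]} -> Prop) (c : k) (x : presented R) : presented R :=
  \pi_(presented R)%qT (c *: repr x).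

Section PresentedScale.
Variables (k : fieldType) (X : choiceType) (R : {malg k[X]} -> Prop).
Local Notation F := {malg k[X]}.
Local Notation pi := (\pi_(presented R))%qT.
Local Notation presented_scale := (@presented_scale k X R).

Lemma pi_eqP (u v : F) : reflect (pi u = pi v) (u - v \in rel_span R).
Proof. by rewrite Quotient.idealrBE; exact: eqP. Qed.

Lemma piZ c u : presented_scale c (pi u) = pi (c *: u).
Proof.
rewrite presented_scale.unlock; apply/pi_eqP; rewrite -scalerBr; apply/rel_spanP.
rewrite -[_ *: _]addr0; apply: span_linear; last exact: span0.
by apply/rel_spanP/pi_eqP; rewrite reprK.
Qed.

Lemma presented_scaleA c d x :
  presented_scale c (presented_scale d x) = presented_scale (c * d) x.
Proof. by elim/quotW: x => u; rewrite (piZ d u) (piZ c) (piZ _ u) scalerA. Qed.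

Lemma presented_scale1 : left_id 1 presented_scale.
Proof. by elim/quotW => u; rewrite (piZ 1 u) scale1r. Qed.

Lemma presented_scaleDr : right_distributive presented_scale +%R.
Proof.
move=> c x y; elim/quotW: x => u; elim/quotW: y => v.
by rewrite -raddfD (piZ c (u + v)) (piZ c u) (piZ c v) scalerDr raddfD.
Qed.

Lemma presented_scaleDl x : {morph presented_scale^~ x : c d / c + d}.
Proof.
by move=> c d; elim/quotW: x => u; rewrite !(piZ _ u) scalerDl raddfD.
Qed.

HB.instance Definition _ := GRing.Zmodule_isLmodule.Build k (presented R)
  presented_scaleA presented_scale1 presented_scaleDr presented_scaleDl.

Lemma pi_linear c (u v : F) : pi (c *: u + v) = c *: pi u + pi v.
Proof. by rewrite raddfD; congr (_ + _); exact/esym/piZ. Qed.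

Lemma piB (u v : F) : pi (u - v) = pi u - pi v.
Proof. by rewrite raddfB. Qed.

Lemma pi_scale c (u : F) : pi (c *: u) = c *: pi u.
Proof. exact/esym/piZ. Qed.

End PresentedScale.

HB.lock Definition gen (k : fieldType) (X : choiceType)
    (R : {malg k[X]} -> Prop) (x : X) : presented R :=
  \pi_(presented R)%qT << x >>.

Section PresentedLift.
Variables (k : fieldType) (X : choiceType) (R : {malg k[X]} -> Prop).
Local Notation F := {malg k[X]}.
Local Notation pi := (\pi_(presented R))%qT.
Local Notation gen := (gen R).
Local Notation presented := (presented R).

Lemma genE x : gen x = pi << x >>.
Proof. by rewrite gen.unlock. Qed.

Section Lift.
Variables (V : lmodType k) (h : X -> V).

Definition ext (m : F) : V := \sum_(x <- msupp m) m@_x *: h x.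

(* The linear map sending gen x to h x, provided h respects the relations
   (lift_gen, lift_linear); otherwise a junk value. *)
Definition lift (q : presented) : V := ext (repr q).

Lemma ext_fset (m : F) (d : {fset X}) : (msupp m `<=` d)%fset ->
  ext m = \sum_(x <- d) m@_x *: h x.
Proof.
move=> le; rewrite /ext (big_fset_incl _ le) //= => x _ xm.
by rewrite mcoeff_outdom // scale0r.
Qed.

Lemma ext_linear c (u v : F) : ext (c *: u + v) = c *: ext u + ext v.
Proof.
pose d := (msupp (c *: u + v) `|` (msupp u `|` msupp v))%fset.
have s1 : (msupp (c *: u + v) `<=` d)%fset by exact: fsubsetUl.
have s2 : (msupp u `<=` d)%fset.
  by apply: (fsubset_trans (fsubsetUl _ (msupp v))); exact: fsubsetUr.
have s3 : (msupp v `<=` d)%fset.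
  by apply: (fsubset_trans (fsubsetUr (msupp u) _)); exact: fsubsetUr.
rewrite (ext_fset s1) (ext_fset s2) (ext_fset s3) scaler_sumr -big_split /=.
by apply: eq_bigr => x _; rewrite mcoeffD mcoeffZ scalerDl scalerA.
Qed.

Lemma ext0 : ext 0 = 0.
Proof. by rewrite /ext msupp0 big_seq_fset0. Qed.

Lemma extZ c u : ext (c *: u) = c *: ext u.
Proof. by rewrite -[c *: u]addr0 ext_linear ext0 addr0. Qed.

Lemma extD u v : ext (u + v) = ext u + ext v.
Proof. by rewrite -[u]scale1r ext_linear !scale1r. Qed.

Lemma extB u v : ext (u - v) = ext u - ext v.
Proof. by rewrite -[- v]scaleN1r extD extZ scaleN1r. Qed.

Lemma extU x : ext << x >> = h x.
Proof. by rewrite /ext msuppU oner_eq0 big_seq_fset1 mcoeffUU scale1r. Qed.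

Hypothesis hR : forall r, R r -> ext r = 0.

Lemma ext_span u : span R u -> ext u = 0.
Proof.
case=> s Hs ->; elim: s Hs => [|x s IH] Hs; first by rewrite big_nil ext0.
rewrite big_cons ext_linear IH => [|y ys]; last by apply: Hs; rewrite inE ys orbT.
by rewrite hR ?scaler0 ?addr0 //; apply: Hs; rewrite inE eqxx.
Qed.

Lemma lift_pi u : lift (pi u) = ext u.
Proof.
apply/eqP; rewrite -subr_eq0 -extB; apply/eqP/ext_span/rel_spanP/pi_eqP.
by rewrite reprK.
Qed.

Lemma lift_gen x : lift (gen x) = h x.
Proof. by rewrite genE lift_pi extU. Qed.

Lemma lift_linear : linear lift.
Proof.
by move=> c x y; rewrite -[x]reprK -[y]reprK -pi_linear !lift_pi ext_linear.
Qed.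

End Lift.

Lemma gen_rel r : R r -> pi r = 0.
Proof.
move=> Rr; have -> : 0 = pi 0 by rewrite raddf0.
apply/pi_eqP; rewrite subr0; apply/rel_spanP.
exists [:: (1, r)]; last by rewrite big_seq1 scale1r.
by move=> x; rewrite inE => /eqP ->.
Qed.

Lemma presented_ind (P : presented -> Prop) :
  P 0 -> (forall c u v, P u -> P v -> P (c *: u + v)) -> (forall x, P (gen x)) ->
  forall q, P q.
Proof.
move=> P0 PL Pg q; rewrite -[q]reprK [repr q]monalgE.
elim: (enum_fset _) => [|x s IH]; first by rewrite big_nil raddf0.
rewrite big_cons.
have -> : << (repr q)@_x *g x >> = (repr q)@_x *: << x >> :> F.
  by apply/malgP => y; rewrite mcoeffZ !mcoeffU mulrnAr mulr1.
by rewrite pi_linear; apply: PL => //; rewrite -genE; exact: Pg.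
Qed.

End PresentedLift.

Section TensorProduct.
Variables (k : fieldType) (U V : lmodType k).

Inductive tensor_rel : {malg k[(U * V)%type]} -> Prop :=
| TensorRelL c u u' v : tensor_rel
    (<< (c *: u + u', v) >> - c *: << (u, v) >> - << (u', v) >>)
| TensorRelR c u v v' : tensor_rel
    (<< (u, c *: v + v') >> - c *: << (u, v) >> - << (u, v') >>).

Definition tensor : lmodType k := presented tensor_rel.

Definition tens (u : U) (v : V) : tensor := gen tensor_rel (u, v).

Definition tensor_lift (W : lmodType k) (f : U -> V -> W) : tensor -> W :=
  @lift k _ tensor_rel W (fun x => f x.1 x.2).

Definition bilinear2 (W : lmodType k) (f : U -> V -> W) : Prop :=
  (forall v, linear (f^~ v)) /\ (forall u, linear (f u)).

Lemma tens_bilinear : bilinear2 tens.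
Proof.
split=> [v c u u'|u c v v']; apply/eqP; rewrite -subr_eq0 opprD addrA; apply/eqP.
  by rewrite -[RHS](gen_rel (TensorRelL c u u' v)) !piB pi_scale -!genE.
by rewrite -[RHS](gen_rel (TensorRelR c u v v')) !piB pi_scale -!genE.
Qed.

Lemma tens_linearl c u u' v : tens (c *: u + u') v = c *: tens u v + tens u' v.
Proof. exact: tens_bilinear.1. Qed.

Lemma tens_linearr c u v v' : tens u (c *: v + v') = c *: tens u v + tens u v'.
Proof. exact: tens_bilinear.2. Qed.

Section Lift.
Variables (W : lmodType k) (f : U -> V -> W).
Hypothesis fB : bilinear2 f.

Lemma tensor_lift_rel r : tensor_rel r -> ext (fun x => f x.1 x.2) r = 0.
Proof.
by case=> [c u u' v|c u v v']; rewrite !extB extZ !extU /= (fB.1, fB.2)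
  addrAC addrK subrr.
Qed.

Lemma tensor_lift_tens u v : tensor_lift f (tens u v) = f u v.
Proof. by rewrite /tensor_lift lift_gen //; exact: tensor_lift_rel. Qed.

Lemma tensor_lift_linear : linear (tensor_lift f).
Proof. by apply: lift_linear; exact: tensor_lift_rel. Qed.
End Lift.

End TensorProduct.



Definition tensor_map (k : fieldType) (U V U' V' : lmodType k)
    (f : U -> U') (g : V -> V') : tensor U V -> tensor U' V' :=
  tensor_lift (fun u v => tens (f u) (g v)).

Lemma tensor_map_bilinear (k : fieldType) (U V U' V' : lmodType k)
    (f : U -> U') (g : V -> V') :
  linear f -> linear g -> bilinear2 (fun u v => tens (f u) (g v)).
Proof.
move=> fL gL; split=> [v c u u'|u c v v'] /=.
  by rewrite fL tens_linearl.
by rewrite gL tens_linearr.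
Qed.

Lemma tensor_map_tens (k : fieldType) (U V U' V' : lmodType k)
    (f : U -> U') (g : V -> V') u v :
  linear f -> linear g -> tensor_map f g (tens u v) = tens (f u) (g v).
Proof.
by move=> fL gL; apply: (tensor_lift_tens (tensor_map_bilinear fL gL)).
Qed.

Lemma tensor_map_linear (k : fieldType) (U V U' V' : lmodType k)
    (f : U -> U') (g : V -> V') :
  linear f -> linear g -> linear (tensor_map f g).
Proof.
by move=> fL gL; apply: (tensor_lift_linear (tensor_map_bilinear fL gL)).
Qed.

Section Words.
Variables (k : fieldType) (A : lmodType k).

Inductive word_rel : {malg k[seq A]} -> Prop :=
| WordRel s t c a b : word_rel
    (<< s ++ (c *: a + b) :: t >> - c *: << s ++ a :: t >> - << s ++ b :: t >>).

(* The direct sum of all tensor powers of A: the relations are homogeneous in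
   the length, so words of length n span the n-th tensor power, and the empty
   word spans a copy of k. *)
Definition qsh : lmodType k := presented word_rel.

Definition word (w : seq A) : qsh := gen word_rel w.

Definition qsh1 : qsh := word [::].

Definition qsh_plus : set qsh :=
  span (fun x => exists (a : A) (w : seq A), x = word (a :: w)).

Definition multilinear (V : lmodType k) (h : seq A -> V) : Prop :=
  forall s t c a b,
    h (s ++ (c *: a + b) :: t) = c *: h (s ++ a :: t) + h (s ++ b :: t).

Lemma word_multilinear : multilinear word.
Proof.
move=> s t c a b; apply/eqP; rewrite -subr_eq0 opprD addrA; apply/eqP.
by rewrite -[RHS](gen_rel (WordRel s t c a b)) !piB pi_scale -!genE.
Qed.

Definition qsh_lift (V : lmodType k) (h : seq A -> V) : qsh -> V :=
  @lift k _ word_rel V h.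

Section Lift.
Variables (V : lmodType k) (h : seq A -> V).
Hypothesis hM : multilinear h.

Lemma qsh_lift_rel r : word_rel r -> ext h r = 0.
Proof.
by case=> s t c a b; rewrite !extB extZ !extU hM addrAC addrK subrr.
Qed.

Lemma qsh_lift_word w : qsh_lift h (word w) = h w.
Proof. by rewrite /qsh_lift lift_gen //; exact: qsh_lift_rel. Qed.

Lemma qsh_lift_linear : linear (qsh_lift h).
Proof. by apply: lift_linear; exact: qsh_lift_rel. Qed.
End Lift.

Lemma linear0E (U V : lmodType k) (f : U -> V) : linear f -> f 0 = 0.
Proof. by move=> fL; have := fL (-1) 0 0; rewrite !scaler0 addr0 scaleN1r addNr. Qed.

Lemma linearZE (U V : lmodType k) (f : U -> V) c u :
  linear f -> f (c *: u) = c *: f u.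
Proof. by move=> fL; have := fL c u 0; rewrite !addr0 linear0E // addr0. Qed.

Lemma linearDE (U V : lmodType k) (f : U -> V) u v :
  linear f -> f (u + v) = f u + f v.
Proof. by move=> fL; have := fL 1 u v; rewrite !scale1r. Qed.

Lemma linearBE (U V : lmodType k) (f : U -> V) u v :
  linear f -> f (u - v) = f u - f v.
Proof. by move=> fL; rewrite -scaleN1r linearDE // linearZE // scaleN1r. Qed.

Lemma linear_sumE (U V : lmodType k) (f : U -> V) I (r : seq I) P (F : I -> U) :
  linear f -> f (\sum_(i <- r | P i) F i) = \sum_(i <- r | P i) f (F i).
Proof.
move=> fL; apply: (big_morph f) => [u v|]; [exact: linearDE|exact: linear0E].
Qed.

Lemma qsh_ext (V : lmodType k) (f g : qsh -> V) :
  linear f -> linear g -> (forall w, f (word w) = g (word w)) -> f =1 g.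
Proof.
move=> fL gL fg; apply: presented_ind => [|c u v fu fv|//].
  by rewrite !linear0E.
by rewrite fL gL fu fv.
Qed.

Lemma qsh_plus_ext (V : lmodType k) (f g : qsh -> V) :
  linear f -> linear g -> (forall a w, f (word (a :: w)) = g (word (a :: w))) ->
  forall h, qsh_plus h -> f h = g h.
Proof.
move=> fL gL fg h [s Hs ->]; rewrite !linear_sumE //.
apply: eq_big_seq => x /Hs [a [w ->]].
by rewrite !linearZE // fg.
Qed.

End Words.
Arguments qsh1 {k A}.

Section Deconcatenation.
Variables (k : fieldType) (A : lmodType k).
Local Notation qsh := (qsh A).

Definition deconc (w : seq A) : tensor qsh qsh :=
  \sum_(0 <= r < (size w).+1) tens (word (take r w)) (word (drop r w)).

Definition Delta : qsh -> tensor qsh qsh := qsh_lift deconc.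

(* Meant on qsh_plus only. *)
Definition Delta' (x : qsh) : tensor qsh qsh :=
  Delta x - tens qsh1 x - tens x qsh1.

Lemma deconc_multilinear : multilinear deconc.
Proof.
move=> s t c a b; rewrite /deconc !size_cat /= scaler_sumr -big_split /=.
apply: eq_bigr => r _; rewrite !take_cat !drop_cat.
case: ltnP => [lt|]; first by rewrite word_multilinear tens_linearr.
case: (r - size s)%N => [|m] _ /=.
  by rewrite (@word_multilinear _ A [::]) tens_linearr.
by rewrite word_multilinear tens_linearl.
Qed.

Lemma Delta_word w : Delta (word w) =
  \sum_(0 <= r < (size w).+1) tens (word (take r w)) (word (drop r w)).
Proof. exact: qsh_lift_word deconc_multilinear w. Qed.

Lemma Delta_linear : linear Delta.
Proof. exact: qsh_lift_linear deconc_multilinear. Qed.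

Lemma Delta'_linear : linear Delta'.
Proof.
move=> c x y; rewrite /Delta' Delta_linear.
rewrite tens_linearl tens_linearr !opprD.
by rewrite [X in X + _ = _]addrACA [LHS]addrACA !scalerBr.
Qed.

Lemma Delta'_word a w : Delta' (word (a :: w)) =
  \sum_(1 <= r < (size w).+1)
    tens (word (take r (a :: w))) (word (drop r (a :: w))).
Proof.
rewrite /Delta' Delta_word big_nat_recl // big_nat_recr //= take_size drop_size.
by rewrite [X in X - _ = _]addrAC subrr add0r addrK big_add1.
Qed.

Definition qcons (a : A) : qsh -> qsh := qsh_lift (fun w : seq A => word (a :: w)).

Lemma qcons_multilinear a : multilinear (fun w : seq A => word (a :: w)).
Proof. by move=> s t c x y; exact: (@word_multilinear _ A (a :: s)). Qed.

Lemma qcons_word a w : qcons a (word w) = word (a :: w).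
Proof. exact: qsh_lift_word (qcons_multilinear a) w. Qed.

Lemma qcons_linear a : linear (qcons a).
Proof. exact: qsh_lift_linear (qcons_multilinear a). Qed.

Lemma qcons_linearl x : linear (qcons^~ x).
Proof.
move=> c a b; move: x; apply: qsh_ext.
- exact: qcons_linear.
- move=> d x y; rewrite !qcons_linear scalerDr !addrA; congr (_ + _).
  by rewrite scalerDr !scalerA -!addrA [c * d]mulrC; congr (_ + _); rewrite addrC.
- by move=> w; rewrite !qcons_word (@word_multilinear _ A [::]).
Qed.

End Deconcatenation.

Section QuasiShuffle.
Variables (k : fieldType) (A : algType k).

(* The quasi-shuffle recursion on a pair of words; star is its bilinear
   extension. *)
Fixpoint stuffle (v : seq A) : seq A -> qsh A :=
  if v is a :: v' then
    fix stuffle_v (w : seq A) : qsh A :=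
      if w is b :: w' then
        qcons a (stuffle v' w) + qcons b (stuffle_v w') +
        qcons (a * b) (stuffle v' w')
      else word v
  else fun w => word w.

Definition star (x y : qsh A) : qsh A :=
  qsh_lift (fun v => qsh_lift (stuffle v) y) x.

Lemma stuffle_multilinearl w : multilinear (stuffle^~ w).
Proof.
move=> s t c a b; elim: s w => [|e s IHs] w /=.
  elim: w => [|d w IHw] /=; first exact: (@word_multilinear _ A [::]).
  rewrite IHw mulrDl -scalerAl !qcons_linearl qcons_linear !scalerDr.
  by rewrite [X in X + _ = _]addrACA [LHS]addrACA.
elim: w => [|d w IHw] /=; first exact: (@word_multilinear _ A (e :: s)).
rewrite !IHs IHw !qcons_linear !scalerDr.
by rewrite [X in X + _ = _]addrACA [LHS]addrACA.
Qed.

Lemma stuffle_multilinearr v : multilinear (stuffle v).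
Proof.
move=> s t c a b; elim: v s => [|e v IHv] s /=; first exact: word_multilinear.
elim: s => [|d s IHs] /=.
  have := IHv [::]; rewrite /= => ->.
  rewrite mulrDr -scalerAr !qcons_linearl qcons_linear !scalerDr.
  by rewrite [X in X + _ = _]addrACA [LHS]addrACA.
rewrite IHs IHv; have := IHv (d :: s); rewrite /= => ->.
rewrite !qcons_linear !scalerDr.
by rewrite [X in X + _ = _]addrACA [LHS]addrACA.
Qed.

Lemma star_multilinear y : multilinear (fun v => qsh_lift (stuffle v) y).
Proof.
move=> s t c a b; move: y; apply: qsh_ext.
- exact: qsh_lift_linear (@stuffle_multilinearr _).
- move=> d x y; rewrite !(qsh_lift_linear (@stuffle_multilinearr _)).
  by rewrite !scalerDr !scalerA [d * c]mulrC addrACA.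
- move=> w; rewrite !(qsh_lift_word (@stuffle_multilinearr _)).
  exact: stuffle_multilinearl.
Qed.

Lemma star_word v w : star (word v) (word w) = stuffle v w.
Proof.
rewrite /star (qsh_lift_word (@star_multilinear _)).
exact: qsh_lift_word (@stuffle_multilinearr _) _.
Qed.

Lemma star_linearl y : linear (star^~ y).
Proof. exact: qsh_lift_linear (@star_multilinear _). Qed.

Lemma star_linearr x : linear (star x).
Proof.
move=> c y z; move: x; apply: qsh_ext.
- exact: star_linearl.
- move=> d x x'; rewrite !star_linearl !scalerDr !scalerA [d * c]mulrC.
  by rewrite addrACA.
- move=> v; rewrite /star !(qsh_lift_word (@star_multilinear _)).
  exact: (qsh_lift_linear (@stuffle_multilinearr _)).
Qed.

Lemma star1l x : star qsh1 x = x.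
Proof.
move: x; apply: (qsh_ext (star_linearr _)) => [c x y //|w].
by rewrite star_word.
Qed.

Lemma star1r x : star x qsh1 = x.
Proof.
move: x; apply: (qsh_ext (star_linearl _)) => [c x y //|[|a w]];
  by rewrite star_word.
Qed.

Lemma star_cons a v b w :
  star (word (a :: v)) (word (b :: w)) =
  qcons a (star (word v) (word (b :: w))) +
  qcons b (star (word (a :: v)) (word w)) +
  qcons (a * b) (star (word v) (word w)).
Proof. by rewrite !star_word. Qed.

Definition mult : tensor A A -> A := tensor_lift (fun x y : A => x * y).

Lemma mult_bilinear : bilinear2 (fun x y : A => x * y).
Proof.
split=> [y c x x'|x c y y'] /=; first by rewrite mulrDl scalerAl.
by rewrite mulrDr scalerAr.
Qed.

Lemma mult_tens x y : mult (tens x y) = x * y.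
Proof. exact: tensor_lift_tens mult_bilinear x y. Qed.

Lemma mult_linear : linear mult.
Proof. exact: tensor_lift_linear mult_bilinear. Qed.

Definition conv (f g : qsh A -> A) : qsh A -> A :=
  mult \o tensor_map f g \o @Delta k A.

(* For h of positive length only: B need not contain 1. *)
Definition unital_maps (B : set A) : set (qsh A -> A) :=
  [set f | [/\ linear f, f qsh1 = 1 & forall h, qsh_plus h -> B (f h)]].

Definition characters : set (qsh A -> A) :=
  [set f | [/\ linear f, f qsh1 = 1 & forall x y, f (star x y) = f x * f y]].

Definition idempotent_rota_baxter (p : A -> A) : Prop :=
  [/\ linear p, forall x, p (p x) = p x
    & forall x y, p x * p y = p (p x * y + x * p y - x * y)].

Definition pminus (p : A -> A) : A -> A := fun x => x - p x.

Definition birkhoff (p : A -> A) (j jp jm : qsh A -> A) : Prop :=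
  [/\ unital_maps (range p) jp, unital_maps (range (pminus p)) jm
    & conv jm j = jp].

Definition bogoliubov (p : A -> A) (j jbar : qsh A -> A) : Prop :=
  [/\ linear jbar, jbar qsh1 = 1 & forall h, qsh_plus h ->
    jbar h = j h - mult (tensor_map (pminus p) id (tensor_map jbar j (Delta' h)))].

Definition letter_map (j : qsh A -> A) : Prop :=
  [/\ linear j, j qsh1 = 1, forall a, j (word [:: a]) = a
    & forall w, (2 <= size w)%N -> j (word w) = 0].

(* iterated p a1 [:: a2; ...; ar] is p_-(...p_-(p_-(a1) a2)...a_(r-1)) ar,
   and a1 if r = 1. *)
Definition iterated (p : A -> A) (a : A) (w : seq A) : A :=
  foldl (fun x b => pminus p x * b) a w.

End QuasiShuffle.

(* G is a group under op, its identity and inverses being taken in G. *)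
Definition is_group (T : Type) (op : T -> T -> T) (G : set T) : Prop :=
  [/\ forall x y, G x -> G y -> G (op x y),
      forall x y z, G x -> G y -> G z -> op x (op y z) = op (op x y) z
    & exists2 e, G e & forall x, G x ->
        [/\ op e x = x, op x e = x
          & exists2 y, G y & op y x = e /\ op x y = e]].

Section WellPosed.
Variables (k : fieldType) (A : algType k).

Lemma letter_map_exists : exists j : qsh A -> A, letter_map j.
Proof.
pose h (w : seq A) := if w is [:: a] then a else if w is [::] then 1 else 0.
have hM : multilinear h.
  by case=> [|x [|y s]] [|z t] c a b; rewrite /= ?scaler0 ?addr0.
exists (qsh_lift h); split=> [|||[|a [|b w]] //]; first exact: qsh_lift_linear.
- exact: qsh_lift_word.
- by move=> a; rewrite qsh_lift_word.
- by rewrite qsh_lift_word.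
Qed.

Section Bogoliubov.
Variables (p : A -> A) (j : qsh A -> A).
Hypotheses (pL : linear p) (jL : linear j).

Let G (f : qsh A -> A) (x : qsh A) : A :=
  j x - mult (tensor_map (pminus p) id (tensor_map f j (Delta' x))).

Let pmL : linear (pminus p).
Proof.
by move=> c x y; rewrite /pminus pL opprD addrACA scalerBr.
Qed.

Let idL : linear (@id A).
Proof. by []. Qed.

Let TL (f : qsh A -> A) : linear f ->
  linear (fun x => mult (tensor_map (pminus p) id (tensor_map f j x))).
Proof.
move=> fL c x y.
rewrite (tensor_map_linear fL jL c x y).
rewrite (tensor_map_linear pmL idL c).
exact: mult_linear.
Qed.

Let GL (f : qsh A -> A) : linear f -> linear (G f).
Proof.
move=> fL c x y; rewrite /G (jL c x y) (Delta'_linear c x y).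
by rewrite (TL fL c) opprD addrACA scalerBr.
Qed.

Let G_word (f : qsh A -> A) a w : linear f ->
  G f (word (a :: w)) = j (word (a :: w)) -
  \sum_(1 <= r < (size w).+1)
    pminus p (f (word (take r (a :: w)))) * j (word (drop r (a :: w))).
Proof.
move=> fL; rewrite /G Delta'_word; congr (_ - _).
rewrite (linear_sumE _ _ _ (TL fL)).
by apply: eq_bigr => r _; rewrite !tensor_map_tens // mult_tens.
Qed.

Let G_agree n (f g : qsh A -> A) : linear f -> linear g ->
  (forall w, (size w <= n)%N -> f (word w) = g (word w)) ->
  forall a w, (size w <= n)%N -> G f (word (a :: w)) = G g (word (a :: w)).
Proof.
move=> fL gL fg a w le; rewrite !G_word //; congr (_ - _).
apply: eq_big_nat => r /andP[_ rw]; rewrite fg //.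
by rewrite (leq_trans _ le) // -ltnS (leq_ltn_trans _ rw) // size_take_min geq_minl.
Qed.

Lemma bogoliubov_unique f g : bogoliubov p j f -> bogoliubov p j g -> f =1 g.
Proof.
move=> [fL f1 fE] [gL g1 gE]; apply: qsh_ext => // w.
have [n] := ubnP (size w); elim: n w => // n IH [|a w]; first by rewrite f1 g1.
rewrite ltnS => le.
have Hw : qsh_plus (word (a :: w)).
  exists [:: (1, word (a :: w))]; last by rewrite big_seq1 scale1r.
  by move=> x; rewrite inE => /eqP ->; exists a, w.
rewrite (fE _ Hw) (gE _ Hw); apply: (G_agree fL gL) (leqnn _) => v vw.
by apply: IH; rewrite (leq_ltn_trans vw).
Qed.

Let eps : qsh A -> k^o := qsh_lift (fun w => (nilp w)%:R : k^o).

Let epsM : multilinear (fun w : seq A => (nilp w)%:R : k^o).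
Proof. by case=> [|x s] t c a b; rewrite /= scaler0 addr0. Qed.

Let epsL c x y : eps (c *: x + y) = c * eps x + eps y.
Proof. exact: (qsh_lift_linear epsM). Qed.

Let step (f : qsh A -> A) (x : qsh A) : A :=
  eps x *: (1 - G f qsh1) + G f x.

Let stepL f : linear f -> linear (step f).
Proof.
move=> fL c x y; rewrite /step (GL fL c x y) epsL.
by move: (1 - _) (G f x) (G f y) => u v w; rewrite scalerDl scalerDr scalerA addrACA.
Qed.

Let step1 f : step f qsh1 = 1.
Proof. by rewrite /step /eps qsh_lift_word // scale1r subrK. Qed.

Let step_cons f a w : step f (word (a :: w)) = G f (word (a :: w)).
Proof. by rewrite /step /eps qsh_lift_word // scale0r add0r. Qed.

Let jb n := iter n step (fun=> 0).

Let jbL n : linear (jb n).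
Proof.
elim: n => [c x y|n IH]; first by rewrite /jb /= scaler0 addr0.
exact: stepL.
Qed.

Let jb_stable n m w :
  (size w < n)%N -> (size w < m)%N -> jb n (word w) = jb m (word w).
Proof.
elim: n m w => // n IH [//|m] [|a w] wn wm; first by rewrite /jb /= !step1.
rewrite /jb !iterS !step_cons -!/(jb _).
apply: (G_agree (n := size w)) => // v le.
by apply: IH; exact: leq_ltn_trans le _.
Qed.

Lemma bogoliubov_exists : exists jbar, bogoliubov p j jbar.
Proof.
pose h w := jb (size w).+1 (word w).
have hM : multilinear h.
  by move=> s t c a b; rewrite /h !size_cat word_multilinear; exact: jbL.
exists (qsh_lift h); split; first exact: qsh_lift_linear.
  by rewrite qsh_lift_word // /h /jb /= step1.
apply: qsh_plus_ext => [||a w]; [exact: qsh_lift_linear|apply: GL|].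
  exact: qsh_lift_linear.
rewrite qsh_lift_word // /h /jb iterS step_cons -/(jb _).
apply: (G_agree (n := size w)) => // [|v le]; first exact: qsh_lift_linear.
by rewrite (qsh_lift_word hM); exact: jb_stable.
Qed.

End Bogoliubov.
End WellPosed.

(* Main.v *)
(** For a linear unital j, the Bogoliubov map computes the Birkhoff factors
    j_+ = p_+ o jbar and j_- = - p_- o jbar by induction on the word length; for
    the letter map only the last term of the Bogoliubov recursion survives, which
    gives the iterated formula. For A commutative, the multiplicativity of the
    coproduct turns a decomposition of a character j into the identity
    j_+(v * w) - j_-(v * w) = j_+(v) j_+(w) - j_-(v) j_-(w), by induction on the
    total length; since A is the direct sum of the subalgebras A_+ and A_-, both
    factors are characters. Convolution inverses of characters are the instance
    p_+ = 0 of this argument. *)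
Require Import Defs.
From mathcomp Require Import all_boot all_algebra.
From mathcomp Require Import boolp classical_sets.

Set Implicit Arguments.
Unset Strict Implicit.
Unset Printing Implicit Defensive.

Import GRing.Theory.
Local Open Scope ring_scope.

(** * The convolution product on linear maps, its unit, and characters *)

Section Convolution.
Variables (k : fieldType) (A : algType k).
Implicit Types (f g h : qsh A -> A) (a b : A) (v w : seq A) (x y : qsh A).

Lemma comp_linear (U V W : lmodType k) (F : V -> W) (G : U -> V) :
  linear F -> linear G -> linear (F \o G).
Proof. by move=> FL GL c x y /=; rewrite GL FL. Qed.

Lemma conv_linear f g : linear f -> linear g -> linear (conv f g).
Proof.
move=> fL gL; apply: comp_linear (@Delta_linear _ _).
exact: comp_linear (@mult_linear _ _) (tensor_map_linear fL gL).
Qed.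

Lemma conv_word f g w : linear f -> linear g ->
  conv f g (word w) =
  \sum_(0 <= r < (size w).+1) f (word (take r w)) * g (word (drop r w)).
Proof.
move=> fL gL; rewrite /conv /= Delta_word.
rewrite (linear_sumE _ _ _ (tensor_map_linear fL gL)).
rewrite (linear_sumE _ _ _ (@mult_linear _ _)).
by apply: eq_bigr => r _; rewrite tensor_map_tens // mult_tens.
Qed.

Lemma conv1 f g : linear f -> linear g ->
  conv f g qsh1 = f qsh1 * g qsh1.
Proof. by move=> fL gL; rewrite conv_word // big_nat1. Qed.

(** Only the cut before [a] leaves this letter to [g]; at every other cut it heads the left leg and
    can be absorbed into [f]. Inductions on words therefore generalise over [f]. *)
Lemma conv_qcons f g a x : linear f -> linear g ->
  conv f g (qcons a x) =
  f qsh1 * g (qcons a x) + conv (f \o qcons a) g x.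
Proof.
move=> fL gL.
have faL : linear (f \o qcons a) by exact: comp_linear fL (qcons_linear _).
move: x; apply: qsh_ext.
- exact: comp_linear (conv_linear fL gL) (qcons_linear _).
- move=> c x y; rewrite qcons_linear gL (conv_linear faL gL) mulrDr.
  by rewrite -scalerAr scalerDr addrACA.
- move=> w; rewrite qcons_word !conv_word // big_nat_recl //=.
  by under eq_bigr => i _ do rewrite -qcons_word.
Qed.

(** Here [c] is an element of A, not a scalar: associativity meets the left factor [f qsh1] produced
    by [conv_qcons]. *)
Lemma conv_linearl c f g h : linear f -> linear g -> linear h ->
  conv (fun x => c * f x + g x) h =1 fun x => c * conv f h x + conv g h x.
Proof.
move=> fL gL hL.
have fgL : linear (fun x => c * f x + g x).
  by move=> d x y; rewrite fL gL mulrDr -scalerAr scalerDr addrACA.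
apply: qsh_ext; first exact: conv_linear.
  move=> d x y; rewrite (conv_linear fL hL) (conv_linear gL hL).
  by rewrite mulrDr -scalerAr scalerDr addrACA.
move=> w; rewrite !conv_word // mulr_sumr -big_split /=.
by apply: eq_bigr => r _; rewrite mulrDl mulrA.
Qed.

(** Stripping the first letter with [conv_qcons] gives an induction on words that avoids triple
    tensor products. *)
Lemma conv_assoc f g h : linear f -> linear g -> linear h ->
  conv f (conv g h) = conv (conv f g) h.
Proof.
move=> fL gL hL; apply: funext; apply: qsh_ext.
- by apply: conv_linear => //; exact: conv_linear.
- by apply: conv_linear => //; exact: conv_linear.
move=> w; elim: w f g fL gL => [|a w IH] f g fL gL.
  by rewrite !conv1 //; [rewrite mulrA|exact: conv_linear..].
have faL : linear (f \o qcons a) by exact: comp_linear fL (qcons_linear _).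
have gaL : linear (g \o qcons a) by exact: comp_linear gL (qcons_linear _).
rewrite -qcons_word !conv_qcons //; [|exact: conv_linear..].
rewrite IH // conv1 //.
have -> : conv f g \o qcons a =
    fun x => f qsh1 * (g \o qcons a) x + conv (f \o qcons a) g x.
  by apply: funext => x /=; rewrite conv_qcons.
rewrite conv_linearl //; last exact: conv_linear.
by rewrite mulrDr mulrA addrA.
Qed.

(** The counit of QSh(A) followed by the unit map of A. *)
Definition conv_unit : qsh A -> A := qsh_lift (fun w => (nilp w)%:R : A).

Lemma conv_unit_multilinear : multilinear (fun w : seq A => (nilp w)%:R : A).
Proof. by case=> [|x s] t c a b; rewrite /= scaler0 addr0. Qed.

Lemma conv_unit_linear : linear conv_unit.
Proof. exact: qsh_lift_linear conv_unit_multilinear. Qed.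

Lemma conv_unit_word w : conv_unit (word w) = (nilp w)%:R.
Proof. exact: qsh_lift_word conv_unit_multilinear w. Qed.

Lemma conv_unit_qcons a x : conv_unit (qcons a x) = 0.
Proof.
move: x; apply: (@qsh_ext _ _ _ (conv_unit \o qcons a)).
- exact: comp_linear conv_unit_linear (qcons_linear _).
- by move=> c x y; rewrite scaler0 addr0.
- by move=> w; rewrite /= qcons_word conv_unit_word.
Qed.

Lemma conv_unitl f : linear f -> conv conv_unit f = f.
Proof.
move=> fL; apply: funext; apply: qsh_ext => //.
  exact: conv_linear conv_unit_linear fL.
move=> w; rewrite conv_word //; last exact: conv_unit_linear.
rewrite big_nat_recl // conv_unit_word take0 drop0 mul1r big_nat big1 ?addr0 //.
move=> i /andP[_ iw]; rewrite conv_unit_word.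
by case: w iw => [//|b w] _; rewrite mul0r.
Qed.

Lemma conv_unitr f : linear f -> conv f conv_unit = f.
Proof.
move=> fL; apply: funext; apply: qsh_ext => //.
  exact: conv_linear fL conv_unit_linear.
move=> w; rewrite conv_word //; last exact: conv_unit_linear.
rewrite big_nat_recr //= conv_unit_word take_size drop_size mulr1.
rewrite big_nat big1 ?add0r // => i /andP[_ iw].
by rewrite conv_unit_word /nilp size_drop subn_eq0 leqNgt iw mulr0.
Qed.

(* The coproduct is multiplicative, as seen after applying f and g to its legs. *)
Lemma conv_star f g v w : linear f -> linear g ->
  conv f g (star (word v) (word w)) =
  \sum_(0 <= i < (size v).+1) \sum_(0 <= j < (size w).+1)
    f (star (word (take i v)) (word (take j w))) *
    g (star (word (drop i v)) (word (drop j w))).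
Proof.
elim: v w f g => [|a v IHv] w f g fL gL.
  rewrite big_nat1 star1l conv_word //.
  by apply: eq_bigr => j _; rewrite !star1l.
elim: w f fL => [|b w IHw] f fL.
  rewrite star1r conv_word //.
  by apply: eq_bigr => i _; rewrite big_nat1 !star1r.
have qL c : linear (f \o qcons c) by exact: comp_linear fL (qcons_linear _).
have cL := conv_linear fL gL.
rewrite star_cons !(linearDE _ _ cL) !conv_qcons // IHv // IHw // IHv //=.
have split_col (F : nat -> nat -> A) m n :
    \sum_(0 <= i < m) \sum_(0 <= j < n.+1) F i j =
    \sum_(0 <= i < m) F i 0%N +
    \sum_(0 <= i < m) \sum_(0 <= j < n) F i j.+1.
  by rewrite -big_split /=; apply: eq_bigr => i _; rewrite big_nat_recl.
(* The right-hand sum is cut into the corner i = j = 0, the rest of the row i = 0, the rest of the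
   column j = 0, and the block i, j > 0. The recursion for [star] splits the corner in three on the
   second leg and the block in three on the first leg. *)
rewrite [RHS]big_nat_recl //= [X in _ = X + _]big_nat_recl //=.
rewrite [X in _ = _ + X]split_col [X in _ + X + _ + _ = _]split_col.
rewrite [X in _ + (_ + X) + _ = _]big_nat_recl //=.
rewrite star1l star_cons !(linearDE _ _ gL) !mulrDr.
have -> : \sum_(0 <= i < (size v).+1)
      f (star (word (a :: take i v)) (word [::])) *
      g (star (word (drop i v)) (word (b :: w))) =
    \sum_(0 <= i < (size v).+1)
      f (qcons a (star (word (take i v)) (word [::]))) *
      g (star (word (drop i v)) (word (b :: w))).
  by apply: eq_bigr => i _; rewrite !star1r qcons_word.
have -> : \sum_(0 <= i < (size w).+1)
      f (star (word [::]) (word (b :: take i w))) *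
      g (star (word (a :: v)) (word (drop i w))) =
    \sum_(0 <= i < (size w).+1)
      f (qcons b (star (word [::]) (word (take i w)))) *
      g (star (word (a :: v)) (word (drop i w))).
  by apply: eq_bigr => i _; rewrite !star1l qcons_word.
have -> : \sum_(0 <= i < (size v).+1) \sum_(0 <= j < (size w).+1)
      f (star (word (a :: take i v)) (word (b :: take j w))) *
      g (star (word (drop i v)) (word (drop j w))) =
    \sum_(0 <= i < (size v).+1) \sum_(0 <= j < (size w).+1)
      f (qcons a (star (word (take i v)) (word (b :: take j w)))) *
      g (star (word (drop i v)) (word (drop j w))) +
    \sum_(0 <= i < (size v).+1) \sum_(0 <= j < (size w).+1)
      f (qcons b (star (word (a :: take i v)) (word (take j w)))) *
      g (star (word (drop i v)) (word (drop j w))) +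
    \sum_(0 <= i < (size v).+1) \sum_(0 <= j < (size w).+1)
      f (qcons (a * b) (star (word (take i v)) (word (take j w)))) *
      g (star (word (drop i v)) (word (drop j w))).
  rewrite -!big_split; apply: eq_bigr => i _ /=.
  rewrite -!big_split; apply: eq_bigr => j _ /=.
  by rewrite star_cons !(linearDE _ _ fL) !mulrDl.
(* Of the eight summands on the left, 1, 4, 7 form the corner, 5 the row, 2 the column, and 3, 6, 8
   the block. *)
by rewrite [LHS](AC ((1*2)*(1*2)*2) (1*4*7*5*(2*(3*6*8))))%AC.
Qed.

(** Bilinearity reduces multiplicativity to words, and [qsh1] is the unit of [star]. *)
Lemma character_words f : linear f -> f qsh1 = 1 ->
  (forall a v b w, f (star (word (a :: v)) (word (b :: w))) =
                   f (word (a :: v)) * f (word (b :: w))) ->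
  characters f.
Proof.
move=> fL f1 fM; split=> // x y; move: x.
apply: (@qsh_ext _ _ _ (fun x => f (star x y)) (fun x => f x * f y)).
- exact: comp_linear fL (star_linearl _).
- by move=> c x z; rewrite fL mulrDl scalerAl.
move=> v; move: y.
apply: (@qsh_ext _ _ _ (f \o star (word v)) (fun y => f (word v) * f y)).
- exact: comp_linear fL (star_linearr _).
- by move=> c x z; rewrite fL mulrDr scalerAr.
move: v => [|a v] [|b w] /=; rewrite ?star1l ?star1r ?f1 ?mul1r ?mulr1 //.
Qed.

Lemma conv_unit_character : characters conv_unit.
Proof.
apply: character_words; first exact: conv_unit_linear.
  by rewrite conv_unit_word.
move=> a v b w; rewrite star_cons !(linearDE _ _ conv_unit_linear).
by rewrite !conv_unit_qcons !conv_unit_word mulr0 !addr0.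
Qed.

(** By [conv_star] both sides are sums over pairs of cuts; commutativity swaps the two inner factors
    of each term. *)
Lemma conv_character f g : (forall x y : A, x * y = y * x) ->
  characters f -> characters g -> characters (conv f g).
Proof.
move=> AC [fL f1 fM] [gL g1 gM].
apply: character_words; first exact: conv_linear.
  by rewrite conv1 // f1 g1 mulr1.
move=> a v b w; rewrite conv_star // !conv_word // big_distrlr /=.
apply: eq_bigr => i _; apply: eq_bigr => j _.
by rewrite fM gM -!mulrA; congr (_ * _); rewrite !mulrA [f _ * g _]AC.
Qed.

(* f sends c x to c times the counit of x, and the counit is multiplicative. *)
Lemma letter_map_character f : letter_map f -> characters f.
Proof.
move=> [fL f1 fa f0].
have f_cons a w : f (word (a :: w)) = a * conv_unit (word w).
  by rewrite conv_unit_word; case: w => [|b w]; rewrite ?fa ?mulr1 // f0 ?mulr0.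
have f_qcons a x : f (qcons a x) = a * conv_unit x.
  move: x; apply: (@qsh_ext _ _ _ (f \o qcons a) (fun x => a * conv_unit x)).
  - exact: comp_linear fL (qcons_linear _).
  - by move=> c x y; rewrite conv_unit_linear mulrDr scalerAr.
  - by move=> w; rewrite /= qcons_word f_cons.
have [_ _ eM] := conv_unit_character.
apply: character_words => // a v b w.
(* The terms headed by [a] and [b] alone vanish, since the counit kills the nonempty word left over;
   the contracted letter [a * b] gives the product. *)
rewrite star_cons !(linearDE _ _ fL) !f_qcons !f_cons !eM.
rewrite !conv_unit_word /= mul0r !mulr0 !add0r -mulrA mulr_natl.
by case: v => [|c v]; case: w => [|d w]; rewrite /= ?(mulr1, mulr0, mul0r, mul1r).
Qed.

End Convolution.

Arguments conv_unit {k A}.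

(** * Birkhoff decomposition of a linear unital map *)

Section Birkhoff.
Variables (k : fieldType) (A : algType k) (p : A -> A) (j : qsh A -> A).
Hypotheses (p_rb : idempotent_rota_baxter p) (jL : linear j) (j1 : j qsh1 = 1).
Implicit Types (jp jm jbar : qsh A -> A) (a b : A) (v w : seq A).

Let pL : linear p. Proof. by case: p_rb. Qed.
Let pp x : p (p x) = p x. Proof. by case: p_rb. Qed.

Lemma pminus_linear : linear (pminus p).
Proof. by move=> c x y; rewrite /pminus pL opprD addrACA scalerBr. Qed.

Lemma range_rotaE x : range p x <-> p x = x.
Proof. by split=> [[y _ <-]|<-]; [exact: pp|exists x]. Qed.

Lemma range_pminusE x : range (pminus p) x <-> p x = 0.
Proof.
split=> [[y _ <-]|px]; first by rewrite linearBE // pp subrr.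
by exists x; rewrite // /pminus px subr0.
Qed.

(** On A_+ the Rota-Baxter identity collapses to x y = p (x y), so A_+ is a subalgebra. *)
Lemma range_rotaM x y : p x = x -> p y = y -> p (x * y) = x * y.
Proof.
move=> px py; case: p_rb => _ _ RB; have := RB x y.
by rewrite px py addrK => <-.
Qed.

(** On A_-, the kernel of p, the identity reads 0 = p (- x y). *)
Lemma range_pminusM x y : p x = 0 -> p y = 0 -> p (x * y) = 0.
Proof.
move=> px py; case: p_rb => _ _ RB; have := RB x y.
rewrite px py !mul0r mulr0 addr0 sub0r -scaleN1r linearZE // scaleN1r.
by move/esym/eqP; rewrite oppr_eq0 => /eqP.
Qed.

Lemma take_cons (T : Type) (x : T) s r : (0 < r)%N ->
  take r (x :: s) = x :: take r.-1 s.
Proof. by case: r. Qed.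

Lemma qsh_plus_cons a w : qsh_plus (word (a :: w)).
Proof.
exists [:: (1, word (a :: w))]; last by rewrite big_seq1 scale1r.
by move=> x; rewrite inE => /eqP ->; exists a, w.
Qed.

Lemma bogoliubov_cons jbar a w : bogoliubov p j jbar ->
  jbar (word (a :: w)) = j (word (a :: w)) -
  \sum_(1 <= r < (size w).+1)
    pminus p (jbar (word (take r (a :: w)))) * j (word (drop r (a :: w))).
Proof.
move=> [bL _ bE]; rewrite bE; last exact: qsh_plus_cons.
have idL : linear (@id A) by [].
rewrite Delta'_word; congr (_ - _).
rewrite (linear_sumE _ _ _ (tensor_map_linear bL jL)).
rewrite (linear_sumE _ _ _ (tensor_map_linear pminus_linear idL)).
rewrite (linear_sumE _ _ _ (@mult_linear _ _)).
apply: eq_bigr => r _.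
by rewrite !tensor_map_tens ?mult_tens //; exact: pminus_linear.
Qed.

Lemma conv_cons (f : qsh A -> A) a w : linear f -> f qsh1 = 1 ->
  conv f j (word (a :: w)) = j (word (a :: w)) +
  \sum_(1 <= r < (size w).+1)
    f (word (take r (a :: w))) * j (word (drop r (a :: w))) +
  f (word (a :: w)).
Proof.
move=> fL f1; rewrite conv_word // big_nat_recl // big_nat_recr //=.
by rewrite f1 mul1r take_size drop_size j1 mulr1 addrA big_add1.
Qed.

Lemma birkhoff_exists : exists jp jm, birkhoff p j jp jm.
Proof.
have [jbar jbarB] := bogoliubov_exists pL jL.
have [bL b1 _] := jbarB.
have qL := pminus_linear.
(* The counit term only affects the empty word, where it corrects - p_-(1) to 1. *)
pose jm x := conv_unit x * (1 + pminus p 1) - pminus p (jbar x).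
have jmL : linear jm.
  move=> c x y; rewrite /jm conv_unit_linear bL qL mulrDl -scalerAl.
  by rewrite opprD addrACA -scalerBr.
have jm1 : jm qsh1 = 1 by rewrite /jm conv_unit_word b1 mul1r addrK.
have jm_cons a w : jm (word (a :: w)) = - pminus p (jbar (word (a :: w))).
  by rewrite /jm conv_unit_word mul0r sub0r.
have jp_cons a w : conv jm j (word (a :: w)) = p (jbar (word (a :: w))).
  rewrite conv_cons // jm_cons.
  under eq_big_nat => r /andP[r0 _].
    rewrite take_cons // jm_cons -take_cons // mulNr; over.
  (* The terms other than [jm] itself add up to [jbar], and jbar - p_-(jbar) = p_+(jbar). *)
  rewrite sumrN -(bogoliubov_cons _ _ jbarB).
  by rewrite /pminus opprB addrC subrK.
have jpL := conv_linear jmL jL.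
exists (conv jm j), jm; split=> //; split=> //.
- by rewrite conv1 // jm1 j1 mulr1.
- move=> h hP; apply/range_rotaE; move: h hP.
  apply: (@qsh_plus_ext _ _ _ (p \o conv jm j)) => // [|a w].
    exact: comp_linear.
  by rewrite /= jp_cons pp.
- move=> h hP; apply/range_pminusE; move: h hP.
  apply: (@qsh_plus_ext _ _ _ (p \o jm) (fun=> 0)) => [|c x y|a w].
  + exact: comp_linear.
  + by rewrite scaler0 addr0.
  + rewrite /= jm_cons -scaleN1r linearZE // /pminus linearBE // pp subrr.
    by rewrite scaler0.
Qed.

(** Once [jm] is known on proper prefixes, [conv jm j = jp] reads jp = jbar + jm on the word;
    applying p fixes [jp] and kills [jm]. *)
Lemma birkhoff_bogoliubov jbar jp jm : bogoliubov p j jbar ->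
  birkhoff p j jp jm -> forall a w,
  jp (word (a :: w)) = p (jbar (word (a :: w))) /\
  jm (word (a :: w)) = - pminus p (jbar (word (a :: w))).
Proof.
move=> jbarB [[jpL jp1 jpP] [jmL jm1 jmP] jE] a w.
have [n] := ubnP (size w); elim: n w => // n IH w; rewrite ltnS => le.
have E : jp (word (a :: w)) = jbar (word (a :: w)) + jm (word (a :: w)).
  rewrite -jE conv_cons // (bogoliubov_cons _ _ jbarB) -sumrN.
  congr (_ + _ + _); apply: eq_big_nat => r /andP[r0 rw].
  rewrite -mulNr; congr (_ * _); rewrite take_cons //.
  apply: (IH _ _).2; apply: leq_trans le.
  by rewrite size_take_min gtn_min prednK // (rw : (r <= size w)%N).
have pjp := (range_rotaE _).1 (jpP _ (qsh_plus_cons a w)).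
have pjm := (range_pminusE _).1 (jmP _ (qsh_plus_cons a w)).
have jpE : jp (word (a :: w)) = p (jbar (word (a :: w))).
  by rewrite -pjp E linearDE // pjm addr0.
split=> //; rewrite /pminus opprB -jpE E.
by rewrite addrC addKr.
Qed.

Lemma birkhoff_character jp jm : (forall x y : A, x * y = y * x) ->
  characters j -> birkhoff p j jp jm -> characters jp /\ characters jm.
Proof.
move=> AC jC [[jpL jp1 jpP] [jmL jm1 jmP] jE].
have [_ _ jM] := jC.
suff jmC : characters jm by split=> //; rewrite -jE; exact: conv_character.
(* The star product of nonempty words is a sum of elements [qcons c x], so it stays in positive
   length. Taking [B] to be [p] or [pminus p] expresses membership in A_- or A_+. *)
have p_plus (f : qsh A -> A) (B : A -> A) : linear f -> linear B ->
    (forall h, qsh_plus h -> B (f h) = 0) ->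
    forall a v b w, B (f (star (word (a :: v)) (word (b :: w)))) = 0.
  move=> fL BL fB a v b w; rewrite star_cons.
  have BfL := comp_linear BL fL.
  have qB c x : B (f (qcons c x)) = 0.
    move: x; apply: (@qsh_ext _ _ _ (B \o (f \o qcons c)) (fun=> 0)).
    + exact: comp_linear BL (comp_linear fL (qcons_linear _)).
    + by move=> d x y; rewrite scaler0 addr0.
    + by move=> u; rewrite /= qcons_word fB //; exact: qsh_plus_cons.
  by rewrite -[LHS]/((B \o f) _) !(linearDE _ _ BfL) /= !qB !addr0.
suff jmM n v w : (size v + size w < n)%N ->
    jm (star (word v) (word w)) = jm (word v) * jm (word w).
  by apply: character_words => // a v b w; exact: jmM (ltnSn _).
elim: n v w => // n IH [|a v] [|b w];
  rewrite ?star1l ?star1r ?jm1 ?mul1r ?mulr1 // ltnS => le.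
set V := a :: v; set W := b :: w.
have jpV : p (jp (word V)) = jp (word V).
  by apply/range_rotaE; apply: jpP; exact: qsh_plus_cons.
have jpW : p (jp (word W)) = jp (word W).
  by apply/range_rotaE; apply: jpP; exact: qsh_plus_cons.
have jmV : p (jm (word V)) = 0.
  by apply/range_pminusE; apply: jmP; exact: qsh_plus_cons.
have jmW : p (jm (word W)) = 0.
  by apply/range_pminusE; apply: jmP; exact: qsh_plus_cons.
have jmS : p (jm (star (word V) (word W))) = 0.
  by apply: (p_plus jm p jmL pL) => h /jmP/range_pminusE.
have jpS : p (jp (star (word V) (word W))) = jp (star (word V) (word W)).
  have := p_plus jp (pminus p) jpL pminus_linear.
  move=> /(_ _ a v b w) H; apply/esym/eqP; rewrite -subr_eq0; apply/eqP/H.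
  by move=> h /jpP/range_rotaE E; rewrite /pminus E subrr.
have {}le : (size V + size W <= n)%N by [].
clearbody V W.
(* Both sides are sums over pairs of cuts minus the term with two full prefixes, the one out of
   reach of the induction hypothesis. The remaining terms agree by induction and multiplicativity of
   [j]. *)
have E : jp (star (word V) (word W)) - jm (star (word V) (word W)) =
    jp (word V) * jp (word W) - jm (word V) * jm (word W).
  rewrite -jE conv_star // !conv_word // big_distrlr /=.
  rewrite [in LHS]big_nat_recr //= [X in _ + X - _ = _]big_nat_recr //=.
  rewrite [in RHS]big_nat_recr //= [X in _ = _ + X - _]big_nat_recr //=.
  rewrite !take_size !drop_size star1l j1 !mulr1 !addrA !addrK.
  have term i l : (i <= size V)%N -> (l <= size W)%N ->
      (i < size V)%N || (l < size W)%N ->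
      jm (star (word (take i V)) (word (take l W))) *
      j (star (word (drop i V)) (word (drop l W))) =
      jm (word (take i V)) * j (word (drop i V)) *
      (jm (word (take l W)) * j (word (drop l W))).
    move=> iV lW il; rewrite IH.
      by rewrite jM -!mulrA; congr (_ * _); rewrite !mulrA [jm _ * j _]AC.
    rewrite !size_takel //; apply: leq_trans le.
    case/orP: il => il; first by rewrite -addSn leq_add.
    by rewrite -addnS leq_add.
  congr (_ + _).
    apply: eq_big_nat => i /andP[_ iV]; apply: eq_big_nat => l /andP[_ lW].
    by apply: term; rewrite ?iV // ltnW.
  apply: eq_big_nat => l /andP[_ lW].
  have := term (size V) l (leqnn _) (ltnW lW).
  by rewrite lW orbT take_size drop_size j1 mulr1 => ->.
(* Projecting [E] to A_+ along A_- isolates [jp]; the identity for [jm] is what remains of [E]. *)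
have jpE : jp (star (word V) (word W)) = jp (word V) * jp (word W).
  have := congr1 p E; rewrite !(linearBE _ _ pL) jpS jmS.
  by rewrite range_rotaM // range_pminusM // !subr0.
by move: E; rewrite jpE => /addrI/oppr_inj.
Qed.

(** Since [j] kills suffixes of length at least 2, the recursion on a word ending in b reduces to
    minus p_- of [jbar] of the preceding prefix, times b. Induction from the right end matches the
    [foldl] of [iterated]. *)
Lemma bogoliubov_letter_map jbar a w : letter_map j -> bogoliubov p j jbar ->
  jbar (word (a :: w)) = (-1) ^+ size w *: iterated p a w.
Proof.
move=> [_ _ ja j0] jbarB; elim/last_ind: w => [|w b IH].
  by rewrite (bogoliubov_cons _ _ jbarB) big_geq // ja subr0 scale1r.
rewrite (bogoliubov_cons _ _ jbarB) j0; last by rewrite /= size_rcons.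
rewrite sub0r size_rcons big_nat_recr //= big_nat big1 => [|r /andP[r0 rw]].
  rewrite add0r -cats1 take_size_cat // drop_size_cat // ja IH.
  rewrite (linearZE _ _ pminus_linear) /iterated foldl_cat /= exprS mulN1r.
  by rewrite scaleNr -scalerAl.
(* Here r is at most [size w], so at least two of the [size w + 2] letters are left to [j]. *)
rewrite j0 ?mulr0 // -(prednK r0) /= size_drop size_rcons.
by rewrite ltn_subRL addn1 ltnS prednK.
Qed.

End Birkhoff.

(** * The group of characters of QSh(A) in a commutative algebra *)

Lemma zero_rota_baxter (k : fieldType) (A : algType k) :
  idempotent_rota_baxter (fun _ : A => 0).
Proof.
by split=> // [c x y|x y]; rewrite ?mul0r // scaler0 addr0.
Qed.

Section CharacterGroup.
Variables (k : fieldType) (A : algType k).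
Hypothesis mulAC : forall x y : A, x * y = y * x.

(* For the Rota-Baxter map p = 0 one has A_+ = 0, so the Birkhoff
   decomposition j_- * j = j_+ says that j_- is the inverse of j. *)
Lemma character_inverse (f : qsh A -> A) : characters f ->
  exists2 g, characters g & conv g f = conv_unit.
Proof.
move=> fC; have [fL f1 _] := fC.
have [jp [jm jB]] := birkhoff_exists (zero_rota_baxter A) fL f1.
have [_ jmC] := birkhoff_character (zero_rota_baxter A) fL f1 mulAC fC jB.
exists jm => //; case: jB => [[jpL jp1 jpP] _ ->].
apply: funext; apply: qsh_ext => //; first exact: conv_unit_linear.
case=> [|a w]; rewrite conv_unit_word //.
by have [y _ <-] := jpP _ (qsh_plus_cons a w).
Qed.

Lemma characters_group : is_group (@conv k A) (@characters k A).
Proof.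
have linC f : characters f -> linear f by case.
split=> [f g|f g h fC gC hC|]; first exact: conv_character.
  by apply: conv_assoc; exact: linC.
exists conv_unit => [|f fC]; first exact: conv_unit_character.
split; [exact/conv_unitl/linC|exact/conv_unitr/linC|].
have [g gC gf] := character_inverse fC.
have [h hC hg] := character_inverse gC.
exists g => //; split=> //.
(* The left inverse g is two-sided: its own left inverse h satisfies h = h (g f) = (h g) f = f. *)
suff <- : h = f by [].
rewrite -[h]conv_unitr -?gf; last exact: linC.
by rewrite conv_assoc ?hg ?conv_unitl //; exact: linC.
Qed.

End CharacterGroup.

Theorem proposition4 (k : fieldType) (k_char0 : [pchar k] =i pred0)
    (A : algType k) (p : A -> A) (p_rb : idempotent_rota_baxter p)
    (j : qsh A -> A) (j_letter : letter_map j) :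
  [/\ exists jp jm : qsh A -> A, birkhoff p j jp jm,
      forall jbar jp jm : qsh A -> A,
        bogoliubov p j jbar -> birkhoff p j jp jm ->
        forall (a : A) (w : seq A),
          [/\ jp (word (a :: w)) = p (jbar (word (a :: w))),
              jp (word (a :: w)) = (-1) ^+ size w *: p (iterated p a w),
              jm (word (a :: w)) = - pminus p (jbar (word (a :: w)))
            & jm (word (a :: w)) =
                (-1) ^+ (size w).+1 *: pminus p (iterated p a w)]
    & (forall x y : A, x * y = y * x) ->
        is_group (@conv k A) (@characters k A) /\
        (forall jp jm : qsh A -> A, birkhoff p j jp jm ->
          characters jp /\ characters jm)].
Proof.
have [pL _ _] := p_rb; have [jL j1 _ _] := j_letter; split.
- exact: birkhoff_exists.
- move=> jbar jp jm jbarB jB a w.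
  have [-> ->] := birkhoff_bogoliubov p_rb jL j1 jbarB jB a w.
  rewrite (bogoliubov_letter_map p_rb jL a w j_letter jbarB).
  split=> //; first by rewrite linearZE.
  by rewrite (linearZE _ _ (pminus_linear p_rb)) exprS mulN1r scaleNr.
- move=> mulAC; split; first exact: characters_group.
  move=> jp jm; apply: birkhoff_character => //.
  exact: letter_map_character.
Qed.
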